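(* For all positive integers $n$, $$L_{2n-1}=U^{(0)}\{L_{2n-2}\}\quad\text{and}\quad L_{2n}=U^{(1)}\{L_{2n-1}\}.$$
   Context: $(a;b)_\infty=\prod_{k\ge 0}(1-ab^k)$. Define integers $a(m)$ by $\sum_{m\ge 0}a(m)q^m=\dfrac{(q^2;q^2)^5_{\infty}}{(q;q)^3_{\infty}(q^4;q^4)^2_{\infty}}$. Let $\lambda_{2n-1}=\frac{19\cdot 5^{2n-1}+1}{24}$ and $\lambda_{2n}=\frac{23\cdot 5^{2n}+1}{24}$. Define $L_0=1$ and for $n\ge 1$ $$L_{2n-1}=\frac{(q^5;q^5)^3_{\infty}(q^{20};q^{20})^2_{\infty}}{(q^{10};q^{10})^5_{\infty}}\sum_{m=0}^{\infty} a(5^{2n-1}m+\lambda_{2n-1})q^{m+1},\qquad L_{2n}=\frac{(q;q)^3_{\infty}(q^{4};q^{4})^2_{\infty}}{(q^{2};q^{2})^5_{\infty}}\sum_{m=0}^{\infty} a(5^{2n}m+\lambda_{2n})q^{m+1}.$$ For a Laurent series $f=\sum_{m\ge M}c(m)q^m$ define $U_5\{f\}=\sum_{5m\ge M}c(5m)q^m$. Let $$A(q)=q\frac{(q^{2};q^{2})^5_{\infty}}{(q;q)^3_{\infty}(q^{4};q^{4})^2_{\infty}}\cdot \frac{(q^{25};q^{25})^3_{\infty}(q^{100};q^{100})^2_{\infty}}{(q^{50};q^{50})^5_{\infty}},$$ and define $U^{(0)}\{f\}=U_5\{A(q)f\}$ and $U^{(1)}\{f\}=U_5\{f\}$. *)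

(* Defs.v *)
From HB Require Import structures.
From mathcomp Require Import all_boot all_order all_algebra.
From mathcomp Require Import boolp classical_sets fsbigop.
From mathcomp Require Import zify.

Set Implicit Arguments.
Unset Strict Implicit.
Unset Printing Implicit Defensive.

Import Order.TTheory GRing.Theory Num.Theory.
Local Open Scope ring_scope.

Section Laurent.
Variable R : comNzRingType.

(** Formal Laurent series: elements of R((q)), with coefficients indexed by Z *)
Record laurent := Laurent {
  coef : int -> R;
  coef_bounded : exists M : int, forall m, m < M -> coef m = 0 }.

Implicit Types f g h : laurent.

Lemma laurentP f g : coef f =1 coef g -> f = g.
Proof.
case: f g => [f Hf] [g Hg] /= fg; have {}fg : f = g by apply: funext.
by subst g; congr Laurent; apply: Prop_irrelevance.
Qed.

HB.instance Definition _ := gen_eqMixin laurent.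
HB.instance Definition _ := gen_choiceMixin laurent.

Definition lower f (M : int) := forall m, m < M -> coef f m = 0.

Lemma lower_ex f : exists M, lower f M. Proof. exact: coef_bounded. Qed.

Lemma lower_le f M N : N <= M -> lower f M -> lower f N.
Proof. by move=> NM fM m mN; apply: fM; apply: lt_le_trans NM. Qed.

Lemma eq_lower f g M : lower f M -> lower g M ->
  (forall k : nat, coef f (M + k%:Z) = coef g (M + k%:Z)) -> f = g.
Proof.
move=> fM gM fg; apply: laurentP => m.
have [mM|Mm] := ltP m M; first by rewrite fM ?gM.
have -> : m = M + (absz (m - M))%:Z by lia.
exact: fg.
Qed.

Fact lzero_subproof : exists M : int, forall m, m < M -> (fun=> 0 : R) m = 0.
Proof. by exists 0. Qed.
Definition lzero := Laurent lzero_subproof.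

Fact lopp_subproof f :
  exists M : int, forall m, m < M -> (fun n => - coef f n) m = 0.
Proof. by have [M fM] := lower_ex f; exists M => m /fM ->; rewrite oppr0. Qed.
Definition lopp f := Laurent (lopp_subproof f).

Fact ladd_subproof f g :
  exists M : int, forall m, m < M -> (fun n => coef f n + coef g n) m = 0.
Proof.
have [M fM] := lower_ex f; have [N gN] := lower_ex g; exists (Num.min M N) => m.
by rewrite lt_min => /andP[/fM -> /gN ->]; rewrite addr0.
Qed.
Definition ladd f g := Laurent (ladd_subproof f g).

Fact laddA : associative ladd.
Proof. by move=> f g h; apply: laurentP => m; rewrite /= addrA. Qed.
Fact laddC : commutative ladd.
Proof. by move=> f g; apply: laurentP => m; rewrite /= addrC. Qed.
Fact ladd0 : left_id lzero ladd.
Proof. by move=> f; apply: laurentP => m; rewrite /= add0r. Qed.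
Fact laddN : left_inverse lzero lopp ladd.
Proof. by move=> f; apply: laurentP => m; rewrite /= addNr. Qed.

HB.instance Definition _ := GRing.isZmodule.Build laurent laddA laddC ladd0 laddN.

(* The family below has finite support for each n, since f and g are bounded
   below. *)
Definition mulcoef f g (n : int) : R :=
  \sum_(i \in [set: int]) coef f i * coef g (n - i).

Lemma mulcoefE f g M N n K : lower f M -> lower g N ->
  n < M + N + K%:Z ->
  mulcoef f g n = \sum_(k < K) coef f (M + k%:Z) * coef g (n - (M + k%:Z)).
Proof.
move=> fM gN nK.
pose r := [seq M + k%:Z | k <- iota 0 K].
have ur : uniq r by rewrite map_inj_uniq ?iota_uniq // => i j; lia.
transitivity (\sum_(i <- r) coef f i * coef g (n - i)); last first.
  rewrite big_map -(big_mkord xpredT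
    (fun k => coef f (M + k%:Z) * coef g (n - (M + k%:Z)))) /index_iota.
  by rewrite subn0.
rewrite [RHS]fsbig_seq //; apply/esym; apply: fsbig_widen => // i [_ /= ir].
have [iM|Mi] := ltP i M; first by rewrite fM ?mul0r.
have [iK|Ki] := ltP i (M + K%:Z); last by rewrite gN ?mulr0 //; lia.
case: ir; apply/mapP; exists (absz (i - M)); last by lia.
by rewrite mem_iota; lia.
Qed.

Lemma mulcoef_lower f g M N : lower f M -> lower g N ->
  forall n, n < M + N -> mulcoef f g n = 0.
Proof. by move=> fM gN n nMN; rewrite (mulcoefE (K := 0) fM gN) ?big_ord0 ?addr0. Qed.

Fact lmul_subproof f g : exists M : int, forall m, m < M -> mulcoef f g m = 0.
Proof.
have [M fM] := lower_ex f; have [N gN] := lower_ex g.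
by exists (M + N); apply: mulcoef_lower.
Qed.
Definition lmul f g := Laurent (lmul_subproof f g).

Lemma lower_mul f g M N : lower f M -> lower g N -> lower (lmul f g) (M + N).
Proof. exact: mulcoef_lower. Qed.

Definition trunc f (M : int) (K : nat) : {poly R} :=
  \poly_(i < K) coef f (M + i%:Z).

Lemma lmul_trunc f g M N K k : lower f M -> lower g N -> (k < K)%N ->
  coef (lmul f g) (M + N + k%:Z) = (trunc f M K * trunc g N K)`_k.
Proof.
move=> fM gN kK; rewrite /= (mulcoefE (K := k.+1) fM gN); last by lia.
rewrite coefM; apply: eq_bigr => i _; rewrite !coef_poly.
have ik : (i <= k)%N by rewrite -ltnS.
rewrite !ifT; [|lia..]; congr (_ * coef g _); lia.
Qed.

Fact lmulC : commutative lmul.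
Proof.
move=> f g; have [M fM] := lower_ex f; have [N gN] := lower_ex g.
apply: (@eq_lower _ _ (M + N)); first exact: lower_mul.
  by rewrite addrC; apply: lower_mul.
move=> k; rewrite (lmul_trunc (K := k.+1)) // addrC [M + N]addrC addrC.
by rewrite (lmul_trunc (K := k.+1)) // mulrC.
Qed.

Fact lmulA : associative lmul.
Proof.
move=> f g h; have [M fM] := lower_ex f; have [N gN] := lower_ex g.
have [P hP] := lower_ex h.
have gh := lower_mul gN hP; have fg := lower_mul fM gN.
apply: (@eq_lower _ _ (M + (N + P))); first exact: lower_mul.
  by rewrite addrA; apply: lower_mul.
move=> k; rewrite (lmul_trunc (K := k.+1)) // addrA (lmul_trunc (K := k.+1)) //.
transitivity ((trunc f M k.+1 * (trunc g N k.+1 * trunc h P k.+1))`_k).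
  rewrite 2!coefM; apply: eq_bigr => i _; congr (_ * _).
  by rewrite coef_poly ifT ?(lmul_trunc (K := k.+1)) //; lia.
rewrite mulrA 2!coefMr; apply: eq_bigr => i _; congr (_ * _).
by rewrite coef_poly ifT ?(lmul_trunc (K := k.+1)) //; lia.
Qed.

Fact lmulDl : left_distributive lmul ladd.
Proof.
move=> f g h; apply: laurentP => n /=.
have [M0 fM0] := lower_ex f; have [N0 gN0] := lower_ex g.
have [P hP] := lower_ex h; pose M : int := Num.min M0 N0.
have fM : lower f M by apply: lower_le fM0; rewrite /M; lia.
have gM : lower g M by apply: lower_le gN0; rewrite /M; lia.
have fgM : lower (ladd f g) M by move=> m mM /=; rewrite fM ?gM ?addr0.
have nK : n < M + P + (absz (n - (M + P))%R).+1%:Z by lia.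
rewrite (mulcoefE fgM hP nK) (mulcoefE fM hP nK) (mulcoefE gM hP nK) -big_split.
by apply: eq_bigr => i _; rewrite /= mulrDl.
Qed.

(** q^n *)
Fact lmono_subproof (n : int) :
  exists M : int, forall m, m < M -> (fun m => (m == n)%:R : R) m = 0.
Proof. by exists n => m mn; rewrite (lt_eqF mn). Qed.
Definition lmono (n : int) := Laurent (lmono_subproof n).

Lemma lower_mono n : lower (lmono n) n.
Proof. by move=> m mn /=; rewrite (lt_eqF mn). Qed.

Lemma coef_lmonoM n f m : coef (lmul (lmono n) f) m = coef f (m - n).
Proof.
have [M fM] := lower_ex f.
have mK : m < n + M + (absz (m - (n + M))%R).+1%:Z by lia.
rewrite /= (mulcoefE (@lower_mono n) fM mK) big_ord_recl /= addr0 eqxx mul1r.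
rewrite big1 ?addr0 // => i _.
have /negPf -> : n + (lift ord0 i : 'I__)%:Z != n by rewrite lift0; lia.
by rewrite mul0r.
Qed.

Fact lmul1 : left_id (lmono 0) lmul.
Proof. by move=> f; apply: laurentP => m; rewrite coef_lmonoM subr0. Qed.

Fact lone_neq0 : lmono 0 != 0.
Proof.
by apply/eqP => /(congr1 (fun f => coef f 0)) /= /eqP; rewrite oner_eq0.
Qed.

HB.instance Definition _ :=
  GRing.Zmodule_isComNzRing.Build laurent lmulA lmulC lmul1 lmulDl lone_neq0.

(* Inverses are chosen classically; by [ps1_unit] all denominators used below
   are units. *)
Definition lunit : {pred laurent} := fun f => `[< exists g, g * f = 1 >].

Definition linv f : laurent :=
  if pselect (exists g, g * f = 1) is left e then sval (cid e) else f.

Fact lmulV : {in lunit, left_inverse 1 linv *%R}.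
Proof.
move=> f /asboolP fU; rewrite /linv; case: pselect => [e|//].
by case: (cid e).
Qed.
Fact lunitP f g : g * f = 1 -> lunit f.
Proof. by move=> gf; apply/asboolP; exists g. Qed.
Fact linv_out : {in [predC lunit], linv =1 id}.
Proof.
by move=> f /asboolP fU; rewrite /linv; case: pselect => // e; case: fU.
Qed.

HB.instance Definition _ :=
  GRing.ComNzRing_hasMulInverse.Build laurent lmulV lunitP linv_out.

(** The power series \sum_(m >= 0) c m q^m *)
Definition pscoef (c : nat -> R) (m : int) : R := if m is Posz k then c k else 0.
Fact pseries_subproof c : exists M : int, forall m, m < M -> pscoef c m = 0.
Proof. by exists 0; case. Qed.
Definition pseries c := Laurent (pseries_subproof c).

(** \sum_m c(m) q^m |-> \sum_m c(5 m) q^m *)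
Fact U5_subproof f :
  exists M : int, forall m, m < M -> (fun n : int => coef f (5 * n)) m = 0.
Proof.
by have [M fM] := lower_ex f; exists (- (absz M)%:Z) => m mM; apply: fM; lia.
Qed.
Definition U5 f := Laurent (U5_subproof f).

(** The product (q^i; q^j)_oo = \prod_(k >= 0) (1 - q^(i + j k)), for i, j > 0.
   For such i, j the factors with k > m do not affect the coefficient of q^m
   (see [qpochE] below). *)
Definition qpoch_trunc (i j n : nat) : {poly R} :=
  \prod_(k < n) (1 - 'X^(i + j * k)).
Definition qpoch (i j : nat) : laurent :=
  pseries (fun m => (qpoch_trunc i j m.+1)`_m).

Lemma qpochE i j n m : (0 < j)%N -> (m < n)%N ->
  (0 < i)%N -> coef (qpoch i j) m%:Z = (qpoch_trunc i j n)`_m.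
Proof.
move=> j0 mn i0 /=; elim: n mn => // n IHn; rewrite ltnS leq_eqVlt.
case/orP=> [/eqP -> //|mn]; rewrite IHn // [in RHS]/qpoch_trunc big_ord_recr /=.
rewrite -/(qpoch_trunc i j n) mulrBr mulr1 coefB coefMXn ifT ?subr0 //; nia.
Qed.

(* Power series with constant term 1. *)
Definition ps1 f := lower f 0 /\ coef f 0 = 1.

Lemma ps1_mul f g : ps1 f -> ps1 g -> ps1 (f * g).
Proof.
move=> [f0 f1] [g0 g1]; split; first by rewrite -[0]addr0; apply: lower_mul.
have -> : coef (f * g) 0 = mulcoef f g 0 by [].
by rewrite (mulcoefE (K := 1) f0 g0) // big_ord1 /= subrr f1 g1 mulr1.
Qed.

Lemma ps1_exp f n : ps1 f -> ps1 (f ^+ n).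
Proof.
move=> f1; elim: n => [|n IHn]; last by rewrite exprS; apply: ps1_mul.
by split=> //; apply: lower_mono.
Qed.

Lemma ps1_inv_ex f : ps1 f -> exists2 g, ps1 g & g * f = 1.
Proof.
move=> [f0 f1].
pose step (s : seq R) :=
  rcons s (- \sum_(i < size s) s`_i * coef f ((size s)%:Z - i%:Z)).
pose s n := iter n step [:: 1].
have ss n : size (s n) = n.+1 by elim: n => //= n IHn; rewrite size_rcons IHn.
have sE n i : (i <= n)%N -> (s n)`_i = (s i)`_i.
  elim: n => [|n IHn]; first by rewrite leqn0 => /eqP ->.
  rewrite leq_eqVlt => /orP[/eqP -> //|]; rewrite ltnS => le_in.
  by rewrite /= nth_rcons ss ltnS le_in IHn.
pose g := pseries (fun n => (s n)`_n).
have g0 : lower g 0 by case.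
exists g; first by split.
apply: (@eq_lower _ _ 0).
- by rewrite -[0]addr0; apply: lower_mul.
- exact: lower_mono.
move=> k; rewrite add0r.
have -> : coef (g * f) k%:Z = mulcoef g f k%:Z by [].
rewrite (mulcoefE (K := k.+1) g0 f0); last by lia.
rewrite big_ord_recr /= !add0r subrr f1 mulr1.
case: k => [|k]; first by rewrite big_ord0 add0r.
rewrite [s k.+1]/= nth_rcons ss ltnn eqxx.
apply/eqP; rewrite subr_eq0; apply/eqP; apply: eq_bigr => i _.
by rewrite add0r add0n (@sE k) // -ltnS.
Qed.

Lemma ps1_unit f : ps1 f -> f \is a GRing.unit.
Proof. by move=> /ps1_inv_ex[g _ /lunitP]. Qed.

Lemma ps1_inv f : ps1 f -> ps1 f^-1.
Proof.
move=> f1; have [g g1 gf] := ps1_inv_ex f1.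
by rewrite -[f^-1]mul1r -gf mulrK ?ps1_unit.
Qed.

Lemma ps1_qpoch i j : (0 < i)%N -> ps1 (qpoch i j).
Proof.
move=> i0; split=> /=; first by case.
by rewrite /qpoch_trunc big_ord1 muln0 addn0 coefB coef1 coefXn (ltn_eqF i0) subr0.
Qed.

End Laurent.

(** (q^k; q^k)_oo over the integers *)
Definition E (k : nat) : laurent int := qpoch int k k.

Definition qexp (n : nat) : laurent int := lmono int n%:Z.

(* The quotient has no negative powers of q, so [a] gives all its
   coefficients, cf. [pseries_a]. *)
Definition a (m : nat) : int :=
  coef (E 2 ^+ 5 / (E 1 ^+ 3 * E 4 ^+ 2)) m%:Z.

(* Both divisions by 24 are exact, cf. [lambdaE]. *)
Definition lambda (n : nat) : nat :=
  (if odd n then (19 * 5 ^ n + 1) %/ 24 else (23 * 5 ^ n + 1) %/ 24)%N.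

Definition L (n : nat) : laurent int :=
  if n == 0%N then 1
  else if odd n then
    (E 5 ^+ 3 * E 20 ^+ 2) / E 10 ^+ 5 *
      (qexp 1 * pseries (fun m => a (5 ^ n * m + lambda n)))
  else
    (E 1 ^+ 3 * E 4 ^+ 2) / E 2 ^+ 5 *
      (qexp 1 * pseries (fun m => a (5 ^ n * m + lambda n))).

Definition A : laurent int :=
  qexp 1 * (E 2 ^+ 5 / (E 1 ^+ 3 * E 4 ^+ 2)) *
    ((E 25 ^+ 3 * E 100 ^+ 2) / E 50 ^+ 5).

Definition U0 (f : laurent int) : laurent int := U5 (A * f).
Definition U1 (f : laurent int) : laurent int := U5 f.

Lemma pseries_a : pseries a = E 2 ^+ 5 / (E 1 ^+ 3 * E 4 ^+ 2).
Proof.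
have E1 k : (0 < k)%N -> ps1 (E k) by apply: ps1_qpoch.
have [l _] : ps1 (E 2 ^+ 5 / (E 1 ^+ 3 * E 4 ^+ 2)).
  by rewrite -?exprVn; do !(apply: ps1_mul || apply: ps1_inv || apply: ps1_exp);
    apply: E1.
by apply: laurentP; case=> [m|m] //; rewrite l.
Qed.

Lemma lambdaE n :
  (24 * lambda n = (if odd n then 19 else 23) * 5 ^ n + 1)%N.
Proof.
have d k : 5 ^ (k.*2) = 1 %[mod 24].
  by elim: k => // k IHk; rewrite doubleS !expnS mulnA -modnMmr IHk.
have e : (5 ^ n = (if odd n then 5 else 1) * 5 ^ (n./2.*2))%N.
  by rewrite -{1}[n]odd_double_half expnD; case: (odd n).
by rewrite /lambda e; move: (d n./2) => {d e}; case: (odd n); lia.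
Qed.

(* Main.v *)
(** Let [P = E 2 ^+ 5 / (E 1 ^+ 3 * E 4 ^+ 2)].  Multiplication by [h (q ^ 5)]
    before applying [U5] amounts to multiplication by [h] afterwards.  The factor
    [P (q)] of [A] cancels the prefactor of [L] at an even index, and the
    remaining quotient in [q ^ 25] becomes, through [U5], the prefactor in
    [q ^ 5] at the next index; at odd indices the prefactor in [q ^ 5] becomes
    the one in [q].  What is left is [U5] applied to a shifted progression of
    the numbers [a m], and the values of [lambda] match. *)
Require Import Defs.
From HB Require Import structures.
From mathcomp Require Import all_boot all_order all_algebra.
From mathcomp Require Import classical_sets functions fsbigop.
From mathcomp Require Import zify.

Set Implicit Arguments.
Unset Strict Implicit.
Unset Printing Implicit Defensive.

Import Order.TTheory GRing.Theory Num.Theory.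
Local Open Scope ring_scope.

Section Dilation.
Variable R : comNzRingType.
Implicit Types f g h : laurent R.

(* The property of the pair [g(q^5), g(q)] that matters for [U5]; unlike the
   substitution itself it is trivially compatible with products and inverses. *)
Definition dilation5 h g := forall f, U5 (h * f) = g * U5 f.

Lemma dilation5M h1 g1 h2 g2 :
  dilation5 h1 g1 -> dilation5 h2 g2 -> dilation5 (h1 * h2) (g1 * g2).
Proof. by move=> d1 d2 f; rewrite -mulrA d1 d2 mulrA. Qed.

Lemma dilation5X h g n : dilation5 h g -> dilation5 (h ^+ n) (g ^+ n).
Proof.
move=> d; elim: n => [|n IHn]; first by move=> f; rewrite !expr0 !mul1r.
by rewrite !exprS; apply: dilation5M.
Qed.

Lemma dilation5V h g : h \is a GRing.unit -> g \is a GRing.unit ->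
  dilation5 h g -> dilation5 h^-1 g^-1.
Proof. by move=> hU gU d f; rewrite -{2}[f](mulVKr hU) d mulKr. Qed.

(** The hypotheses express h(q) = g(q^5): in the convolution for q^(5n) only indices 5k survive, and
    there [f] is read at 5(n - k). *)
Lemma dilation5P h g :
  (forall m, coef h (5 * m) = coef g m) ->
  (forall m, ~~ (5 %| m)%Z -> coef h m = 0) -> dilation5 h g.
Proof.
move=> hg h0 f; apply: laurentP => n.
transitivity (mulcoef h f (5 * n)); first by [].
transitivity (mulcoef g (U5 f) n); last by [].
rewrite /mulcoef.
pose D : set int := (( *%R 5) @` [set: int])%classic.
rewrite -(@fsbig_widen _ _ _ _ D) //; last first.
  move=> i [_ /= iD]; rewrite h0 ?mul0r //; apply/negP => /dvdzP[k ik].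
  by apply: iD; exists k => //; rewrite ik mulrC.
rewrite fsbig_image; last by move=> i j _ _; lia.
by apply: eq_fsbigr => i _; rewrite /= hg mulrBr.
Qed.

Lemma qpoch_trunc_comp i j d n :
  qpoch_trunc R (d * i) (d * j) n = qpoch_trunc R i j n \Po 'X^d.
Proof.
rewrite /qpoch_trunc rmorph_prod; apply: eq_bigr => k _ /=.
by rewrite comp_polyB comp_polyC comp_Xn_poly -exprM mulnDr mulnA.
Qed.

Lemma dilation5_qpoch i j : (0 < i)%N -> (0 < j)%N ->
  dilation5 (qpoch R (5 * i) (5 * j)) (qpoch R i j).
Proof.
move=> i0 j0; apply: dilation5P => [] [m|m] //.
(* A common truncation length [(5 * m).+1] on both sides lets [qpoch_trunc_comp] compare them. *)
- rewrite -PoszM (@qpochE _ _ _ (5 * m).+1) ?muln_gt0 // qpoch_trunc_comp.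
  rewrite coef_comp_poly_Xn // dvdn_mulr // mulKn //.
  by rewrite (@qpochE _ _ _ (5 * m).+1) //; lia.
- move=> m5; rewrite (@qpochE _ _ _ m.+1) ?muln_gt0 // qpoch_trunc_comp.
  by rewrite coef_comp_poly_Xn // ifN.
Qed.

(** On the left q^(5m) carries [u] at 5m - s = 5(m - 1) + r; the shift to m - 1 is the factor q on
    the right. *)
Lemma U5_progression (u : nat -> R) (s r : nat) : (0 < s)%N -> (s + r = 5)%N ->
  U5 (lmono R s%:Z * pseries u) = lmono R 1 * pseries (fun m => u (5 * m + r)%N).
Proof.
move=> s0 sr; apply: laurentP => m.
transitivity (coef (lmono R s%:Z * pseries u) (5 * m)) => //.
rewrite !coef_lmonoM; case: m => [[|m]|m].
(* At m = 0 both exponents, -s and -1, are negative, so both sides vanish. *)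
- by case: s s0 sr.
- have -> : 5 * m.+1%:Z - s%:Z = (5 * m + r)%N%:Z by lia.
  by have -> : m.+1%:Z - 1 = m%:Z by lia.
- have -> : Negz m - 1 = Negz m.+1 by lia.
  by have -> : 5 * Negz m - s%:Z = Negz (5 * m + 4 + s) by lia.
Qed.

End Dilation.

(** This is 1 / P(q^k). *)
Definition prefactor (k : nat) : laurent int :=
  (E k ^+ 3 * E (4 * k) ^+ 2) / E (2 * k) ^+ 5.

Lemma unit_E k : (0 < k)%N -> E k \is a GRing.unit.
Proof. by move=> k0; apply/ps1_unit/ps1_qpoch. Qed.

Lemma unit_prefactor k : (0 < k)%N -> prefactor k \is a GRing.unit.
Proof. by move=> k0; rewrite /prefactor !unitrM unitrV !unitrX ?unit_E ?muln_gt0. Qed.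

Lemma dilation5_E k : (0 < k)%N -> dilation5 (E (5 * k)) (E k).
Proof. by move=> k0; apply: dilation5_qpoch. Qed.

Lemma dilation5_prefactor k : (0 < k)%N ->
  dilation5 (prefactor (5 * k)) (prefactor k).
Proof.
move=> k0; rewrite /prefactor !(mulnCA _ 5).
apply: dilation5M; first by apply: dilation5M; apply/dilation5X/dilation5_E; lia.
by apply: dilation5V; rewrite ?unitrX ?unit_E //; [..|apply/dilation5X/dilation5_E]; lia.
Qed.

Lemma inv_prefactor1 : (prefactor 1)^-1 = pseries a.
Proof.
by rewrite pseries_a invrM ?invrK // ?unitrV ?unitrM ?unitrX ?unit_E.
Qed.

Lemma A_prefactor : A = prefactor 25 * (qexp 1 / prefactor 1).
Proof. by rewrite mulrC inv_prefactor1 pseries_a. Qed.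

Lemma L_prefactor n : (0 < n)%N ->
  L n = prefactor (if odd n then 5 else 1) *
    (qexp 1 * pseries (fun m => a (5 ^ n * m + lambda n)%N)).
Proof. by rewrite /L; case: n => // n _; case: ifP. Qed.

(** By [lambdaE] the constants are (5 * 23 - 19) / 24 = 4 and (5 * 19 - 23) / 24 = 3, the residues
    [r] that arise from [U5_progression]. *)
Lemma lambdaS n :
  lambda n.+1 = ((if odd n then 4 else 3) * 5 ^ n + lambda n)%N.
Proof.
have := lambdaE n; have := lambdaE n.+1.
by rewrite expnS /=; case: (odd n) => /=; lia.
Qed.

Lemma eq_pseries (R : comNzRingType) (u v : nat -> R) :
  u =1 v -> pseries u = pseries v.
Proof. by move=> uv; apply: laurentP => -[m|m] /=. Qed.

(** Since [L 0] is 1, nothing cancels P(q) in [A]: it supplies the series of [a] itself, and 4 is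
    [lambda 1]. *)
Lemma U0_1 : U0 1 = L 1.
Proof.
rewrite /U0 A_prefactor inv_prefactor1 mulr1.
by rewrite (dilation5_prefactor (k := 5)) // (@U5_progression _ _ 1 4).
Qed.

Lemma U0_L n : (0 < n)%N -> ~~ odd n -> U0 (L n) = L n.+1.
Proof.
move=> n0 no; rewrite /U0 A_prefactor !L_prefactor //= no (negPf no).
rewrite -(mulrA (prefactor 25)) (dilation5_prefactor (k := 5)) //.
rewrite (mulrA _ (prefactor 1)) divrK ?unit_prefactor // (mulrA (qexp 1)).
(* One q comes from [A] and one from [L n], hence s = 2 and r = 3. *)
have -> : qexp 1 * qexp 1 = lmono _ 2.
  by apply: laurentP => m; rewrite coef_lmonoM /=; congr (_%:R); lia.
rewrite (@U5_progression _ _ 2 3) //; congr (_ * (_ * _)).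
apply: eq_pseries => m; congr a.
by rewrite lambdaS (negPf no) expnS; lia.
Qed.

Lemma U1_L n : odd n -> U1 (L n) = L n.+1.
Proof.
move=> no; have n0 : (0 < n)%N by case: n no.
rewrite /U1 !L_prefactor //= no (dilation5_prefactor (k := 1)) //.
(* Here only [L n] brings a q, hence s = 1 and r = 4. *)
rewrite (@U5_progression _ _ 1 4) //; congr (_ * (_ * _)).
apply: eq_pseries => m; congr a.
by rewrite lambdaS no expnS; lia.
Qed.

Theorem theorem4 (n : nat) (hn : (0 < n)%N) :
  L (2 * n - 1) = U0 (L (2 * n - 2)) /\ L (2 * n) = U1 (L (2 * n - 1)).
Proof.
case: n hn => // n _; have -> : (2 * n.+1 - 2 = n.*2)%N by lia.
have -> : (2 * n.+1 - 1 = n.*2.+1)%N by lia.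
have -> : (2 * n.+1 = n.*2.+2)%N by lia.
split; last by rewrite U1_L //= odd_double.
by case: n => [|n]; [rewrite U0_1 | rewrite U0_L ?odd_double].
Qed.
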